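(* Every cyclic loop condition is equivalent to a finite (possibly empty) set of prime cyclic loop conditions.
   Context: A clone is a set of operations of arity $\geq1$ on a fixed nonempty set that contains all projections and is closed under composition. A loop condition $\Sigma$ is an identity $f(x_{\sigma(1)},\dots,x_{\sigma(m)})\approx f(x_{\tau(1)},\dots,x_{\tau(m)})$ with $\sigma,\tau\colon[m]\to[n]$; a clone on a set $A$ satisfies $\Sigma$ if it contains an $m$-ary operation $f$ with $f(x_{\sigma(1)},\dots,x_{\sigma(m)})=f(x_{\tau(1)},\dots,x_{\tau(m)})$ for all $x_1,\dots,x_n\in A$. $\Sigma$ is a cyclic loop condition if the digraph $([n],\{(\sigma(i),\tau(i))\mid i\in[m]\})$ is a finite nonempty disjoint union of directed cycles (a loop counts as a cycle of length 1). For a finite nonempty set $C\subset\mathbb{N}^+$ let $V_C=\{(a,k)\mid a\in C,k\in\mathbb{Z}_a\}$ and $\sigma_C\colon V_C\to V_C$, $(a,k)\mapsto(a,k+1)$. $\Sigma_C$ denotes the cyclic loop condition $f\approx f_{\sigma_C}$: a clone on $A$ satisfies $\Sigma_C$ if it contains an operation $f\colon A^{V_C}\to A$ (identify $V_C$ with $\{1,\dots,|V_C|\}$ by any bijection) with $f(t)=f(t\circ\sigma_C)$ for all $t\in A^{V_C}$. Every cyclic loop condition is equivalent to $\Sigma_C$, where $C$ is the set of lengths of the cycles of its digraph. A prime cyclic loop condition is a condition $\Sigma_P$ where $P$ is a finite nonempty set of primes. A clone satisfies a set of conditions if it satisfies each member (different members use different function symbols); the empty set is satisfied by every clone. Two (sets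 of) conditions are equivalent if they are satisfied by the same clones. *)

(* Defs.v *)
From mathcomp Require Import all_boot finmap.
From mathcomp Require Import boolp classical_sets functions cardinality.

Set Implicit Arguments.
Unset Strict Implicit.
Unset Printing Implicit Defensive.

Local Open Scope classical_set_scope.

Definition op (A : Type) (n : nat) : Type := ('I_n -> A) -> A.

Record clone (A : Type) : Type := Clone {
  clone_op : forall n, set (op A n);
  clone_arity : forall n (f : op A n), clone_op f -> 0 < n;
  clone_proj : forall n (i : 'I_n), clone_op (fun t : 'I_n -> A => t i);
  clone_comp : forall m n (f : op A m) (g : 'I_m -> op A n),
    clone_op f -> (forall i, clone_op (g i)) ->
    clone_op (fun t : 'I_n -> A => f (fun i => g i t))
}.

Record loop_condition : Type := LoopCondition {
  lc_arity : nat;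
  lc_nvars : nat;
  lc_lhs : 'I_lc_arity -> 'I_lc_nvars;
  lc_rhs : 'I_lc_arity -> 'I_lc_nvars
}.

Definition satisfies (A : Type) (K : clone A) (L : loop_condition) : Prop :=
  exists2 f : op A (lc_arity L), clone_op K f &
    forall x : 'I_(lc_nvars L) -> A,
      f (fun i => x (lc_lhs i)) = f (fun i => x (lc_rhs i)).

Definition satisfies_all (A : Type) (K : clone A) (S : set loop_condition) :
    Prop :=
  forall L, S L -> satisfies K L.

Definition equivalent (S T : set loop_condition) : Prop :=
  forall A : Type, inhabited A ->
  forall K : clone A, satisfies_all K S <-> satisfies_all K T.

Definition lc_edge (L : loop_condition) (x y : 'I_(lc_nvars L)) : Prop :=
  exists i, lc_lhs i = x /\ lc_rhs i = y.

(* The disjoint union, over [i : I], of directed cycles of length [a i]; the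
   [i]-th one has vertices ['I_(a i)] and edges [k -> k + 1 mod a i].  The type
   ['Z_(a i)] cannot be used here, as ['Z_1] has two elements. *)
Definition cycles (I : finType) (a : I -> nat) : finType :=
  {i : I & 'I_(a i)}.

Definition cycles_next (I : finType) (a : I -> nat) (u : cycles a) :
    cycles a :=
  Tagged (fun i => 'I_(a i)) (ordS (tagged u)).

Definition cyclic_loop_condition (L : loop_condition) : Prop :=
  exists (I : finType) (a : I -> nat) (h : cycles a -> 'I_(lc_nvars L)),
    [/\ 0 < #|I|, forall i, 0 < a i, bijective h &
        forall u v, lc_edge (h u) (h v) <-> v = cycles_next u].

(* [Sigma C] is f(t) = f(t o sigma_C), with V_C identified with ['I_#|V_C|]
   via [enum_val] and [enum_rank]. *)
Definition Sigma (C : {fset nat}) : loop_condition :=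
  let V := cycles (fun a : C => val a) in
  @LoopCondition #|V| #|V| id
    (fun k => enum_rank (cycles_next (enum_val k : V))).

Definition prime_cyclic_loop_condition (L : loop_condition) : Prop :=
  exists P : {fset nat},
    [/\ P != fset0, forall p, p \in P -> prime p & L = Sigma P].

(* Main.v *)
Require Import Defs.
From mathcomp Require Import all_boot finmap.
From mathcomp Require Import boolp classical_sets functions cardinality.

Local Open Scope classical_set_scope.

(** Let the cycles of [L] have lengths [a i] and let [N] be their product.
    [L] is equivalent to the set of all [Sigma P], where [P] is a set of prime
    divisors of [N] such that each [a i] is divisible by some [p] in [P].  For
    such [P] the cycles of [L] wrap around those of [Sigma P], so [L] implies
    [Sigma P].  For the converse, let [s] be the successor map on the variables
    of [L] and call [m] a period if some operation [g] of the clone satisfies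
    [g (t o s^m) = g t].  Every multiple of some [a i] is a period (take a
    projection), and [L] says that [1] is a period.  Every divisor [m] of [N]
    is a period, by induction on [N / m]: if no [a i] divides [m], then the set
    [P] of primes dividing [N / m] meets the divisors of each [a i], every
    [m * p] with [p] in [P] is a period, and the operation for [Sigma P] applied
    to the translates [g_p (t o s^(m * j))], [j < p], has period [m]. *)

(** Reducing positions mod [b (d i)] wraps cycle [i] around cycle [d i]; it respects the return to 0
    because [b (d i)] divides [a i]. *)
Lemma cycles_next_hom (I J : finType) (a : I -> nat) (b : J -> nat)
    (d : I -> J) :
  (forall j, 0 < b j) -> (forall i, b (d i) %| a i) ->
  exists w : cycles a -> cycles b, {morph w : u / cycles_next u}.
Proof.
move=> b_gt0 dvd_ba.
exists (fun u : cycles a => Tagged (fun j => 'I_(b j))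
  (Ordinal (ltn_pmod (nat_of_ord (tagged u)) (b_gt0 (d (tag u)))))).
case=> i j; congr (Tagged _ _); apply: val_inj => /=.
by rewrite modn_dvdm // -addn1 -[in RHS]addn1 modnDml.
Qed.

Lemma iter_cycles_next (I : finType) (a : I -> nat) (i : I) (j : 'I_(a i)) :
  iter (a i) (@cycles_next I a) (Tagged (fun i => 'I_(a i)) j) =
  Tagged (fun i => 'I_(a i)) j.
Proof.
have a_gt0 : 0 < a i by case: j => j; apply: leq_ltn_trans.
have iterE k : iter k (@cycles_next I a) (Tagged (fun i => 'I_(a i)) j) =
    Tagged (fun i => 'I_(a i)) (Ordinal (ltn_pmod (j + k) a_gt0)).
  elim: k => [|k IHk] /=.
    by congr (Tagged _ _); apply: val_inj; rewrite /= addn0 modn_small.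
  rewrite IHk; congr (Tagged _ _); apply: val_inj => /=.
  by rewrite -addn1 modnDml addn1 addnS.
by rewrite iterE; congr (Tagged _ _); apply: val_inj; rewrite /= modnDr modn_small.
Qed.

Lemma cyclic_successor (L : loop_condition) (I : finType) (a : I -> nat)
    (h : cycles a -> 'I_(lc_nvars L)) :
  bijective h ->
  (forall u v, lc_edge (h u) (h v) <-> v = cycles_next u) ->
  exists s : 'I_(lc_nvars L) -> 'I_(lc_nvars L),
    (forall u, s (h u) = h (cycles_next u)) /\
    (forall x y, lc_edge x y <-> y = s x).
Proof.
case=> h' hK h'K edgeP; exists (fun x => h (cycles_next (h' x))); split.
  by move=> u; rewrite hK.
move=> x y; rewrite -{1}[x]h'K -{1}[y]h'K edgeP; split=> [<-|->] //.
Qed.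

(** Each argument [i] of [f] reads the coordinate [w (lc_lhs i)]; the identity of [L], taken at the
    assignment pulled back along [w], becomes that of [Sigma C]. *)
Lemma satisfies_Sigma_of_hom {A : Type} (K : clone A) (L : loop_condition)
    (C : {fset nat}) (w : 'I_(lc_nvars L) -> cycles (fun c : C => val c)) :
  (forall i, w (lc_rhs i) = cycles_next (w (lc_lhs i))) ->
  satisfies K L -> satisfies K (Sigma C).
Proof.
move=> wE [f Kf fE].
exists (fun t => f (fun i => t (enum_rank (w (lc_lhs i))))).
  exact: (clone_comp Kf (fun i => clone_proj K (enum_rank (w (lc_lhs i))))).
move=> x /=; rewrite (fE (fun v => x (enum_rank (w v)))).
by congr f; apply: funext => i /=; rewrite enum_rankK wE.
Qed.

Section Periods.

Context {A : Type} (K : clone A) {n : nat} (s : 'I_n -> 'I_n).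

Definition has_period (m : nat) : Prop :=
  exists2 g : op A n, clone_op K g &
    forall t, g (fun v => t (iter m s v)) = g t.

Lemma has_period_fix m v : iter m s v = v -> has_period m.
Proof. by move=> sv; exists (fun t => t v) => [|t]; [exact: clone_proj|rewrite sv]. Qed.

Lemma has_period_dvd m k : m %| k -> has_period m -> has_period k.
Proof.
case/dvdnP=> q -> [g Kg gm]; exists g => //.
elim: q => [|q IHq] t //.
rewrite -[RHS]IHq -[RHS]gm; congr g; apply: funext => v.
by rewrite -iterD mulSn addnC.
Qed.

Lemma has_period_Sigma (P : {fset nat}) m :
  satisfies K (Sigma P) -> (forall p, p \in P -> has_period (m * p)) ->
  has_period m.
Proof.
move=> [f Kf fE] perP.
have /choice[g gP] (p : P) : exists g : op A n, clone_op K g /\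
    forall t, g (fun v => t (iter (m * val p) s v)) = g t.
  by have [g Kg gm] := perP _ (valP p); exists g.
pose T t (u : cycles (fun p : P => val p)) : A :=
  g (tag u) (fun v => t (iter (m * nat_of_ord (tagged u)) s v)).
(* A step along the cycles of [P] is a translation of [t] by [s^m]. *)
have T_next t u : T t (cycles_next u) = T (fun v => t (iter m s v)) u.
  case: u => p j; rewrite /T /=.
  have [_ gp] := gP p.
  have [jp|pj] := ltnP j.+1 (val p).
    rewrite modn_small //; congr (g p); apply: funext => v.
    by rewrite -iterD mulnS.
  (* At the last position the step returns to 0; the period [m * p] of [g p] makes up for the lost
     [s^(m * p)]. *)
  have jp : j.+1 = val p by apply/eqP; rewrite eqn_leq pj ltn_ord.
  rewrite [X in X %% _]jp modnn muln0 /= -[LHS]gp; congr (g p).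
  by apply: funext => v; rewrite -iterD -mulnS jp.
exists (fun t => f (fun k => T t (enum_val k))).
  apply: (clone_comp Kf) => k; case: (enum_val k) => p j; rewrite /T /=.
  exact: (clone_comp (gP p).1 (fun v => clone_proj K (iter (m * j) s v))).
move=> t; have /= -> := fE (fun k => T t (enum_val k)).
by congr f; apply: funext => k; rewrite enum_rankK T_next.
Qed.

Lemma has_period1 (I : finType) (a : I -> nat) (N : nat) :
  0 < #|I| -> 0 < N -> (forall i, a i %| N) -> (forall i, has_period (a i)) ->
  (forall P : {fset nat}, P != fset0 -> {subset P <= primes N} ->
     (forall i, exists2 p, p \in P & p %| a i) -> satisfies K (Sigma P)) ->
  has_period 1.
Proof.
move=> /card_gt0P[i0 _] N_gt0 a_dvd perI satP.
suff per k m : m * k = N -> has_period m by apply: (per N); rewrite mul1n.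
elim/ltn_ind: k m => k IHk m mkN.
have [[i /has_period_dvd]|no_dvd] := pselect (exists i, a i %| m).
  exact.
have k_gt0 : 0 < k by move: N_gt0; rewrite -mkN muln_gt0 => /andP[].
(* Were [a i] coprime to [k], then [a i %| m * k] would give [a i %| m]. So their gcd exceeds 1, and
   its least prime divisor serves. *)
have hit i : exists2 p, p \in [fset p in primes k]%fset & p %| a i.
  exists (pdiv (gcdn (a i) k)); last first.
    exact: dvdn_trans (pdiv_dvd _) (dvdn_gcdl _ _).
  rewrite in_fset /= mem_primes k_gt0 (dvdn_trans (pdiv_dvd _) (dvdn_gcdr _ _)).
  rewrite !andbT pdiv_prime // ltn_neqAle eq_sym gcdn_gt0 k_gt0 orbT andbT.
  apply/negP => co; apply: no_dvd; exists i.
  by rewrite -(Gauss_dvdl _ co) mkN.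
apply: (@has_period_Sigma [fset p in primes k]%fset) => [|p].
  apply: satP => // [|p].
    by have [p pk _] := hit i0; apply/fset0Pn; exists p.
  rewrite in_fset /= !mem_primes N_gt0 => /and3P[-> _ pk] /=.
  by rewrite -mkN dvdn_mull.
rewrite in_fset /= mem_primes => /and3P[p_pr _ pk].
apply: (IHk (k %/ p)); first by rewrite ltn_Pdiv // prime_gt1.
by rewrite -mulnA [p * _]mulnC divnK.
Qed.

End Periods.

Lemma satisfies_of_has_period1 {A : Type} (K : clone A) (L : loop_condition)
    (s : 'I_(lc_nvars L) -> 'I_(lc_nvars L)) :
  (forall x y, lc_edge x y <-> y = s x) -> has_period K s 1 -> satisfies K L.
Proof.
move=> edgeP [g Kg gs].
(* [e v] is an argument position of [L] whose edge leaves [v]; [g] reads only these positions. *)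
have /choice[e eP] v : exists i : 'I_(lc_arity L), lc_lhs i = v /\ lc_rhs i = s v.
  exact/edgeP.
exists (fun y => g (fun v => y (e v))).
  exact: (clone_comp Kg (fun v => clone_proj K (e v))).
move=> x; transitivity (g x); first by congr g; apply: funext => v; rewrite (eP v).1.
by rewrite -gs; congr g; apply: funext => v; rewrite (eP v).2.
Qed.

Theorem theorem5p23 (L : loop_condition) (hL : cyclic_loop_condition L) :
  exists S : set loop_condition,
    [/\ finite_set S,
        S `<=` prime_cyclic_loop_condition &
        equivalent [set L] S].
Proof.
have [I [a [h [I_gt0 a_gt0 h_bij]]]] := hL.
move=> /(cyclic_successor _ _ _ _ h_bij)[s [s_h edgeP]].
pose N := \prod_i a i.
have N_gt0 : 0 < N by exact: prodn_gt0.
have a_dvd i : a i %| N by rewrite /N (bigD1 i) //= dvdn_mulr.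
(* Only primes dividing [N] are allowed, which keeps the family finite. *)
pose good (P : {fset nat}) := [/\ P != fset0, {subset P <= primes N} &
  forall i, exists2 p, p \in P & p %| a i].
have good_prime P p : good P -> p \in P -> prime p.
  by case=> _ sub _ /sub; rewrite mem_primes => /and3P[].
exists (Sigma @` good); split.
- apply: finite_image.
  apply: (@sub_finite_set _ _
    [set P | P \in fpowerset [fset p in primes N]%fset]) => [P [_ sub _] /=|].
    by rewrite fpowersetE; apply/fsubsetP => p /sub; rewrite in_fset.
  exact: finite_fset.
- by move=> _ [P gP <-]; exists P; split=> // [|p]; [case: gP|exact: good_prime].
move=> A _ K; split=> [satL _ [P gP <-]|satS _ ->].
- have [_ _ /(_ _)/cid2 hit] := gP.
  pose d i : P := FSetSub (s2valP (hit i)).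
  have p_gt0 (p : P) : 0 < val p by exact: prime_gt0 (good_prime _ _ gP (valP p)).
  have [w w_next] := cycles_next_hom _ _ a val d p_gt0 (fun i => s2valP' (hit i)).
  have [h' hK h'K] := h_bij.
  apply: (satisfies_Sigma_of_hom K L P (w \o h')) (satL _ erefl) => i /=.
  have /edgeP -> : lc_edge (lc_lhs i) (lc_rhs i) by exists i.
  by rewrite -{1}[lc_lhs i]h'K s_h hK w_next.
apply: (satisfies_of_has_period1 K L s edgeP).
apply: (has_period1 K s I a N) => // [i|P P0 sub hit]; last first.
  by apply: satS; exists P.
(* Vertex 0 of the [i]-th cycle is fixed by [s^(a i)]. *)
apply: (has_period_fix K s _ (h (Tagged _ (Ordinal (a_gt0 i))))).
rewrite -[in RHS](iter_cycles_next I a i).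
by elim: (a i) (Tagged _ _) => [|k IHk] u //=; rewrite IHk s_h.
Qed.
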